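(* Let $C_5\in(0,\infty)$ be a constant such that $E^a_{Q,+,0}(e^{tm^a_Q})\leq e^{C_5(t+t^2)}$ for any $a>0$ and $t>0$ (there exists such a constant). Then for any $a>0$ and $t>0$, $$\mathbb{E}^a_{Q,w,0}\left(e^{tA_0}\right)\leq 2 e^{C_5(t+t^2)},\qquad \mathbb{E}^a_{Q,\rho,0}\left(e^{tA_{max}}\right)\leq 2 e^{C_5(t+t^2)} \ \text{ for any boundary condition }\rho.$$
   Context: Let $\beta_c=\frac12\log(1+\sqrt2)$, $Q=[-1/2,1/2]^2$, $Q^a=a\mathbb{Z}^2\cap Q$. $\mathscr{B}(Q^a)$ is the set of nearest neighbour edges of $a\mathbb{Z}^2$ with both endpoints in $Q^a$. A boundary condition $\rho$ is an assignment of values in $\{0,1\}$ to all the other nearest neighbour edges of $a\mathbb{Z}^2$. For $\omega\in\{0,1\}^{\mathscr{B}(Q^a)}$, $\mathscr{C}(Q^a,\rho,\omega)$ is the set of clusters intersecting $Q^a$ of the configuration equal to $\omega$ on $\mathscr{B}(Q^a)$ and to $\rho$ elsewhere (value $1$ meaning open), and $|\mathcal C|$ is the number of vertices of $\mathcal C\cap Q^a$. $\mathbb{P}^a_{Q,\rho,0}$ is the critical FK–Ising measure without external field, $\mathbb{P}^a_{Q,\rho,0}(\omega)\propto 2^{|\mathscr{C}(Q^a,\rho,\omega)|}(1-e^{-2\beta_c})^{o(\omega)}(e^{-2\beta_c})^{c(\omega)}$, with $o(\omega),c(\omega)$ the numbers of open and closed edges of $\omega$; $\mathbb{E}^a_{Q,\rho,0}$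 is its expectation. $\rho=w$ is the wired boundary condition (all edges outside $\mathscr{B}(Q^a)$ open); under it there is a single boundary cluster $\mathcal{C}_0(\omega)$ (the cluster containing all vertices of $Q^a$ with a nearest neighbour outside $Q^a$), and $A_0(\omega):=a^{15/8}|\mathcal{C}_0(\omega)|$. For general $\rho$, $A_{max}(\omega):=a^{15/8}\max_{\mathcal C\in\mathscr{C}(Q^a,\rho,\omega)}|\mathcal C|$. $m^a_Q:=a^{15/8}\sum_{x\in Q^a}\sigma_x$, and $E^a_{Q,+,0}$ is expectation for the Ising model on $Q^a$ at inverse temperature $\beta_c$, zero external field, and plus boundary condition on the vertices of $a\mathbb{Z}^2\setminus Q^a$ adjacent to $Q^a$. The existence of $C_5$ is taken from Camia–Garban–Newman.
   Formalization: ''Any a>0'' is read as 0<a≤a_max, for an arbitrary fixed a_max≥1, in both the assumption on C_5 and the conclusion: with a unbounded no such C_5 exists, since for a>1 Q^a={0} and E(e^{tm}) grows without bound as a→∞. *)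

(* Defs.v *)
From Stdlib Require Import Relations.Relation_Operators.
From mathcomp Require Import all_boot all_order all_algebra finmap.
From mathcomp Require Import all_classical all_reals all_analysis.
From mathcomp Require Import zify.

Set Implicit Arguments.
Unset Strict Implicit.
Unset Printing Implicit Defensive.

Import Order.TTheory GRing.Theory Num.Theory.

Local Open Scope classical_set_scope.
Local Open Scope ring_scope.

(** The point (i, j) : int * int stands for the vertex (a i, a j) of a Z^2. *)
Notation vertex := (int * int)%type.

(** Each unoriented nearest-neighbour edge is encoded exactly once:
    (x, true) is {x, x + (1, 0)} and (x, false) is {x, x + (0, 1)}. *)
Notation edge := (vertex * bool)%type.

Definition src (e : edge) : vertex := e.1.
Definition tgt (e : edge) : vertex :=
  if e.2 then (e.1.1 + 1, e.1.2) else (e.1.1, e.1.2 + 1).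

Definition neighbour (x y : vertex) : Prop :=
  exists e : edge, (src e = x /\ tgt e = y) \/ (src e = y /\ tgt e = x).

(** Connection by a path of open edges in the whole lattice. *)
Definition connected (eta : edge -> bool) : vertex -> vertex -> Prop :=
  clos_refl_sym_trans vertex
    (fun x y => exists e : edge, [/\ eta e : Prop, src e = x & tgt e = y]).

Definition cluster (eta : edge -> bool) (x : vertex) : set vertex :=
  [set y | connected eta x y].

(** Expectation of [f] under the probability on [T] proportional to [w]. *)
Definition gibbs (R : realType) (T : finType) (w f : T -> R) : R :=
  (\sum_x w x * f x) / (\sum_x w x).

Definition beta_c (R : realType) : R := ln (1 + Num.sqrt 2) / 2.

(** The sets of vertices and edges turned into finite types by [fset_set] are
    finite when a > 0, as the lemmas of this section show. *)
Section Domain.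
Variables (R : realType) (a : R).

Definition Qset : set vertex :=
  [set x | `|a * x.1%:~R| <= 1 / 2 /\ `|a * x.2%:~R| <= 1 / 2].

Definition Q : {fset vertex} := fset_set Qset.

Definition inner_edges : set edge := [set e | Qset (src e) /\ Qset (tgt e)].

Definition B : {fset edge} := fset_set inner_edges.

Definition touching_edges : set edge := [set e | Qset (src e) \/ Qset (tgt e)].

Definition Bbar : {fset edge} := fset_set touching_edges.

Definition inner_boundary : set vertex :=
  [set x | Qset x /\ exists2 y, neighbour x y & ~ Qset y].

Lemma QsetE : 0 < a -> exists N : nat,
  Qset = [set x : vertex | (`|x.1| <= N)%N /\ (`|x.2| <= N)%N].
Proof.
move=> a0; exists (Num.truncn (1 / 2 / a)).
have key (i : int) : (`|a * i%:~R| <= 1 / 2) = (`|i| <= Num.truncn (1 / 2 / a))%N.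
  rewrite normrM gtr0_norm// mulrC -ler_pdivlMr//.
  have h : 0 <= 1 / 2 / a by rewrite !divr_ge0// ltW.
  by rewrite truncn_ge_nat// natr_absz intr_norm.
by apply/seteqP; split => x; rewrite /Qset /= !key.
Qed.

Lemma finite_Qset : 0 < a -> finite_set Qset.
Proof.
move=> /QsetE[N ->].
pose s : seq int := [seq k%:Z - N%:Z | k <- iota 0 (N + N).+1].
apply: (@sub_finite_set _ _ ([set` s] `*` [set` s])); last first.
  by apply: finite_setX; exact: finite_seq.
have key (i : int) : (`|i| <= N)%N -> i \in s.
  move=> iN; apply/mapP; exists (absz (i + N%:Z)); first by rewrite mem_iota; lia.
  lia.
by move=> x /= [? ?]; split; exact: key.
Qed.

Lemma finite_touching_edges : 0 < a -> finite_set touching_edges.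
Proof.
move=> /finite_Qset fQ.
pose pred_ (e : edge) : vertex :=
  if e.2 then (e.1.1 - 1, e.1.2) else (e.1.1, e.1.2 - 1).
have fQ2 : finite_set (Qset `*` [set: bool]) by exact: finite_setX.
apply: (@sub_finite_set _ _ ((Qset `*` [set: bool]) `|`
  (fun e => (pred_ e, e.2)) @` (Qset `*` [set: bool]))).
  move=> e [Qe|Qe]; [by left|right].
  exists (tgt e, e.2) => //.
  by case: e {Qe} => [[i j] []]; rewrite /pred_ /tgt /= addrK.
by rewrite finite_setU; split => //; exact: finite_image.
Qed.

Lemma finite_inner_edges : 0 < a -> finite_set inner_edges.
Proof.
move=> /finite_touching_edges; apply: sub_finite_set.
by move=> e [? _]; left.
Qed.

End Domain.

Section FK.
Variables (R : realType) (a : R).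

(** Only the values of [rho] outside [B a] are used. *)
Definition glue (rho : edge -> bool) (w : {ffun B a -> bool}) (e : edge) : bool :=
  if insub e is Some e' then w e' else rho e.

(** The clusters intersecting Q are the clusters of the vertices of Q. *)
Definition clusters (rho : edge -> bool) (w : {ffun B a -> bool}) :
    {fset set vertex} :=
  fset_set [set cluster (glue rho w) x | x in Qset a].

Definition csize (C : set vertex) : nat := #|` fset_set (C `&` Qset a)|.

Definition n_open (w : {ffun B a -> bool}) : nat := #|[pred e | w e]|.
Definition n_closed (w : {ffun B a -> bool}) : nat := #|[pred e | ~~ w e]|.

Definition fk_weight (rho : edge -> bool) (w : {ffun B a -> bool}) : R :=
  2 ^+ #|` clusters rho w|
  * (1 - expR (- (2 * beta_c R))) ^+ n_open w
  * expR (- (2 * beta_c R)) ^+ n_closed w.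

Definition fk_E (rho : edge -> bool) (f : {ffun B a -> bool} -> R) : R :=
  gibbs (fk_weight rho) f.

Definition wired : edge -> bool := fun=> true.

(** For a > 0 there is exactly one such cluster ([boundary_cluster_unique]
    below), so that the default value [set0] is never used. *)
Definition C0 (w : {ffun B a -> bool}) : set vertex :=
  xget set0 [set C | C \in clusters wired w /\ inner_boundary a `<=` C].

Definition A0 (w : {ffun B a -> bool}) : R := a `^ (15 / 8) * (csize (C0 w))%:R.

Definition Amax (rho : edge -> bool) (w : {ffun B a -> bool}) : R :=
  a `^ (15 / 8) * (\max_(C <- clusters rho w) csize C)%:R.

Lemma in_clusters rho w C : 0 < a ->
  (C \in clusters rho w) <-> exists2 x, Qset a x & C = cluster (glue rho w) x.
Proof.
move=> a0; rewrite in_fset_set; last exact/finite_image/finite_Qset.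
by rewrite inE; split => -[x Qx Cx]; exists x.
Qed.

Lemma boundary_cluster_unique w : 0 < a ->
  exists! C, C \in clusters wired w /\ inner_boundary a `<=` C.
Proof.
move=> a0; have [N QE] := QsetE a0; set eta := glue wired w.
have opn e : ~ Qset a (src e) \/ ~ Qset a (tgt e) -> eta e.
  move=> H; rewrite /eta /glue; case: insubP => // e' + _.
  rewrite in_fset_set; last exact: finite_inner_edges.
  by rewrite inE => -[? ?]; case: H.
have csym x y : connected eta x y -> connected eta y x by exact: rst_sym.
have ctr x y z : connected eta x y -> connected eta y z -> connected eta x z.
  by move=> xy yz; exact: rst_trans xy yz.
have vert x y (k : nat) : (N < `|x|)%N ->
    connected eta (x, y) (x, y + k%:Z).
  move=> Nx; elim: k => [|k IH]; first by rewrite addr0; exact: rst_refl.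
  apply: ctr IH _; apply: rst_step; exists ((x, y + k%:Z), false).
  split => //; last by rewrite /tgt /=; congr pair; lia.
  by apply: opn; left; rewrite QE /=; lia.
have hori x y (k : nat) : (N < `|y|)%N ->
    connected eta (x, y) (x + k%:Z, y).
  move=> Ny; elim: k => [|k IH]; first by rewrite addr0; exact: rst_refl.
  apply: ctr IH _; apply: rst_step; exists ((x + k%:Z, y), true).
  split => //; last by rewrite /tgt /=; congr pair; lia.
  by apply: opn; left; rewrite QE /=; lia.
have vert' x y y' : (N < `|x|)%N -> connected eta (x, y) (x, y').
  move=> Nx; have [yy'|/ltW yy'] := leP y y'.
    by have := vert x y (absz (y' - y)) Nx; have -> : y + (absz (y' - y))%:Z = y' by lia.
  apply: csym.
  by have := vert x y' (absz (y - y')) Nx; have -> : y' + (absz (y - y'))%:Z = y by lia.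
have hori' x x' y : (N < `|y|)%N -> connected eta (x, y) (x', y).
  move=> Ny; have [yy'|/ltW yy'] := leP x x'.
    by have := hori x y (absz (x' - x)) Ny; have -> : x + (absz (x' - x))%:Z = x' by lia.
  apply: csym.
  by have := hori x' y (absz (x - x')) Ny; have -> : x' + (absz (x - x'))%:Z = x by lia.
pose p : vertex := (N.+1%:Z, N.+1%:Z).
have outp z : ~ Qset a z -> connected eta z p.
  case: z => x y; rewrite QE /= => H.
  have [xN|xN] := ltnP N `|x|%N.
    by apply: ctr (vert' x y N.+1%:Z xN) _; apply: hori'; lia.
  have yN : (N < `|y|)%N by lia.
  by apply: ctr (hori' x N.+1%:Z y yN) _; apply: vert'; lia.
have bdp z : inner_boundary a z -> connected eta z p.
  move=> [Qz [y [e ze] nQy]]; apply: ctr (outp _ nQy).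
  case: ze => -[sz ty].
    by apply: rst_step; exists e; split => //; apply: opn; right; rewrite ty.
  by apply: csym; apply: rst_step; exists e; split => //; apply: opn; left; rewrite sz.
pose b : vertex := (N%:Z, 0).
have Qb : Qset a b by rewrite QE /=; lia.
have bb : inner_boundary a b.
  split=> //; exists (N%:Z + 1, 0); last by rewrite QE /=; lia.
  by exists (b, true); left.
exists (cluster eta b); split.
  split; first by apply/in_clusters => //; exists b.
  by move=> z /bdp zp; apply: ctr (bdp _ bb) (csym _ _ zp).
move=> C [/(in_clusters _ _ _ a0)[x Qx ->] /(_ b bb) xb].
apply/seteqP; split => z /= bz; first exact: ctr xb bz.
exact: ctr (csym _ _ xb) bz.
Qed.

End FK.

Section Ising.
Variables (R : realType) (a : R).

(** Spins are -1 or +1; outside Q they are +1 (plus boundary condition). *)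
Definition spin (s : {ffun Q a -> bool}) (x : vertex) : R :=
  if insub x is Some x' then (if s x' then 1 else -1) else 1.

(** [Bbar a] contains the edges inside Q and those joining Q to its outer
    boundary. *)
Definition ising_plus_weight (s : {ffun Q a -> bool}) : R :=
  expR (beta_c R * \sum_(e <- Bbar a) spin s (src e) * spin s (tgt e)).

Definition ising_plus_E (f : {ffun Q a -> bool} -> R) : R :=
  gibbs ising_plus_weight f.

Definition magnetization (s : {ffun Q a -> bool}) : R :=
  a `^ (15 / 8) * \sum_(x <- Q a) spin s x.

End Ising.

Arguments clusters {R} a rho w.
Arguments fk_E {R} a rho f.
Arguments A0 {R} a w.
Arguments Amax {R} a rho w.
Arguments ising_plus_E {R} a f.
Arguments magnetization {R} a s.

(* Main.v *)
Require Import Defs.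
From Stdlib Require Import Relations.Relation_Operators.
From mathcomp Require Import all_boot all_order all_algebra finmap.
From mathcomp Require Import all_classical all_reals all_analysis.
From mathcomp Require Import zify ring lra.
Import Order.TTheory GRing.Theory Num.Theory.
Local Open Scope ring_scope.

Set Implicit Arguments.
Unset Strict Implicit.
Unset Printing Implicit Defensive.

(** Write h = t a^(15/8), and let N be the integer with Q^a = {-N, ..., N}^2,
    so that t Amax is h times the number of vertices of the largest cluster.

    Since A0 <= Amax for the wired boundary condition, only Amax matters, and
    the wired boundary condition is the worst one: the random-cluster weights
    satisfy the lattice condition and Amax increases with the open edges, so
    the four functions theorem gives [fk_E_le_wired].  Here 2^(number of
    clusters) is read as the number of +-1 spin assignments on Q that are
    constant on clusters; opening one more edge divides this number by 1 or 2,
    and by 2 exactly when the edge joins two clusters, from which the lattice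
    condition [cspins_lattice] follows edge by edge.

    For the wired measure one uses the Edwards-Sokal coupling.  Spins that are
    constant on clusters and + on the boundary cluster form, once the edges
    are summed out, an Ising model.  If the largest cluster is the boundary
    cluster, flipping all other clusters and using convexity of exp shows that
    e^{h M} has conditional mean at least e^{h |C0|}; if it is another
    cluster, that cluster is + with probability 1/2 and one loses a factor 2.

    The wired measure forces all vertices of Q that have a neighbour outside
    Q to be equal, whereas the plus boundary condition of the Ising model sits
    one lattice step further out.  So the Ising model produced by the coupling
    is the one on {-(N-1), ..., N-1}^2, and the 8N boundary vertices
    contribute a deterministic amount: the outcome, [wired_le_ising], is

      E_w e^{h max|C|} <= max (2, e^{8 N h}) E_{+, N-1} e^{h M}.

    Only one of the two losses occurs: the boundary vertices cost e^{8 N h} if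
    the largest cluster contains them, and the factor 2 is lost if it does
    not.

    The square of half-side N - 1 is Q^{a'} with a' = 1 / (2 (N-1)), so the
    hypothesis at (a', t'), with t' a'^(15/8) = h and hence
    t' <= (1 - 1/N) t, bounds the last factor by e^{C5 (t' + t'^2)}.  It
    remains to absorb 8 N h, which is at most of order t N^(-7/8), into
    log 2 + C5 (t^2 - t'^2), where C5 (t^2 - t'^2) is at least of order
    t^2 / N; by the inequality between arithmetic and geometric means the sum
    is at least of order t N^(-1/2), so this works as soon as C5 is not too
    small.  And it is not: the hypothesis at a = 1, where Q is a single
    vertex, gives C5 >= tanh (4 beta_c) >= 0.94 ([C5_lower]).  The cases
    N = 0 and N = 1 are elementary. *)

(** * The four functions theorem *)

Section FourFunctions.
Variables (R : realFieldType) (T : finType).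
Implicit Types (u v w : {ffun T -> bool}) (f : {ffun T -> bool} -> R).

Definition join u v : {ffun T -> bool} := [ffun x => u x || v x].
Definition meet u v : {ffun T -> bool} := [ffun x => u x && v x].
Definition upd x c u : {ffun T -> bool} := [ffun y => if y == x then c else u y].

(** A sum over configurations taken one coordinate at a time, the shape on which
    the four functions theorem goes through by induction. *)
Fixpoint sum_coords (s : seq T) f u : R :=
  if s is x :: s' then
    sum_coords s' f (upd x true u) + sum_coords s' f (upd x false u)
  else f u.

Lemma sum_coordsE s f u : uniq s ->
  sum_coords s f u = \sum_(w : {ffun T -> bool} | [forall y, (y \in s) || (w y == u y)]) f w.
Proof.
elim: s u => [|x s IH] u /=.
  move=> _; rewrite (big_pred1 u)// => w; apply/forallP/eqP => [h|-> //].
  by apply/ffunP => y; apply/eqP; exact: h.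
case/andP=> xs us; rewrite !IH// [RHS](bigID (fun w => w x)) /=.
have key c w : [forall y, (y \in s) || (w y == upd x c u y)] =
    [forall y, (y \in x :: s) || (w y == u y)] && (w x == c).
  apply/forallP/andP => [h|[/forallP h /eqP wx] y].
    split; last by have := h x; rewrite ffunE eqxx (negbTE xs).
    apply/forallP => y; have := h y; rewrite ffunE in_cons.
    by case: (eqVneq y x).
  have := h y; rewrite ffunE in_cons; case: eqVneq => //= -> _.
  by rewrite wx eqxx orbT.
by congr (_ + _); apply: eq_bigl => w; rewrite key; case: (w x).
Qed.

(** The case of a single coordinate. With p = a1 b0 and q = a0 b1, both at most
    m = c1 d0, and z = c0 d1, one has p q = (a0 b0) (a1 b1) <= m z, so that
    (m - p) (m - q) >= 0 gives p + q <= m + z. *)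
Lemma four_functions1 (a0 a1 b0 b1 c0 c1 d0 d1 : R) :
  0 <= a0 -> 0 <= a1 -> 0 <= b0 -> 0 <= b1 ->
  0 <= c0 -> 0 <= c1 -> 0 <= d0 -> 0 <= d1 ->
  a0 * b0 <= c0 * d0 -> a1 * b0 <= c1 * d0 -> a0 * b1 <= c1 * d0 ->
  a1 * b1 <= c1 * d1 ->
  (a1 + a0) * (b1 + b0) <= (c1 + c0) * (d1 + d0).
Proof.
move=> ha0 ha1 hb0 hb1 hc0 hc1 hd0 hd1 h00 h10 h01 h11.
have [cd0|cd0] := eqVneq (c1 * d0) 0.
  have a10 : a1 * b0 = 0 by apply/le_anti; rewrite mulr_ge0// andbT -cd0.
  have a01 : a0 * b1 = 0 by apply/le_anti; rewrite mulr_ge0// andbT -cd0.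
  have := mulr_ge0 hc0 hd1; nra.
have cd : 0 < c1 * d0 by rewrite lt0r cd0 mulr_ge0.
have prod : (a1 * b0) * (a0 * b1) <= (c1 * d0) * (c0 * d1).
  have := ler_pM (mulr_ge0 ha0 hb0) (mulr_ge0 ha1 hb1) h00 h11; nra.
set p := a1 * b0 in h10 prod *; set q := a0 * b1 in h01 prod *.
set m := c1 * d0 in cd h10 h01 prod *; set z := c0 * d1 in prod *.
have pq : p + q <= m + z.
  rewrite -(ler_pM2l cd).
  have : 0 <= (m - p) * (m - q) by rewrite mulr_ge0// subr_ge0.
  nra.
rewrite /p /q /m /z in pq; nra.
Qed.

(** Ahlswede and Daykin: summing out one coordinate preserves the pointwise
    inequality, by the one-coordinate case. *)
Theorem four_functions (f1 f2 f3 f4 : {ffun T -> bool} -> R) :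
  (forall w, 0 <= f1 w) -> (forall w, 0 <= f2 w) ->
  (forall w, 0 <= f3 w) -> (forall w, 0 <= f4 w) ->
  (forall u v, f1 u * f2 v <= f3 (join u v) * f4 (meet u v)) ->
  (\sum_w f1 w) * (\sum_w f2 w) <= (\sum_w f3 w) * (\sum_w f4 w).
Proof.
move=> p1 p2 p3 p4 h.
have pos s f u : (forall w, 0 <= f w) -> 0 <= sum_coords s f u.
  by move=> pf; elim: s u => //= x s IH u; rewrite addr_ge0.
have key s u v : sum_coords s f1 u * sum_coords s f2 v <=
    sum_coords s f3 (join u v) * sum_coords s f4 (meet u v).
  elim: s u v => [|x s IH] u v /=; first exact: h.
  have jE c d : join (upd x c u) (upd x d v) = upd x (c || d) (join u v).
    by apply/ffunP => y; rewrite !ffunE; case: eqP.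
  have mE c d : meet (upd x c u) (upd x d v) = upd x (c && d) (meet u v).
    by apply/ffunP => y; rewrite !ffunE; case: eqP.
  apply: four_functions1; rewrite ?pos//.
  - by have := IH (upd x false u) (upd x false v); rewrite jE mE.
  - by have := IH (upd x true u) (upd x false v); rewrite jE mE.
  - by have := IH (upd x false u) (upd x true v); rewrite jE mE.
  - by have := IH (upd x true u) (upd x true v); rewrite jE mE.
pose z : {ffun T -> bool} := [ffun=> false].
have all f : \sum_w f w = sum_coords (enum T) f z.
  rewrite sum_coordsE ?enum_uniq//; apply: eq_bigl => w.
  by apply/esym/forallP => y; rewrite mem_enum.
have zz : join z z = z /\ meet z z = z by split; apply/ffunP => y; rewrite !ffunE.
by have := key (enum T) z z; rewrite zz.1 zz.2 -!all.
Qed.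

End FourFunctions.

(** * Spin assignments constant on the classes of an equivalence *)

Section Spins.
Variable T : finType.
Implicit Types (r : rel T) (s : {ffun T -> bool}) (D F : pred T).

Definition const_spins r : {set {ffun T -> bool}} :=
  [set s : {ffun T -> bool} | [forall x, forall y, r x y ==> (s x == s y)]].

Lemma const_spinsP r s :
  reflect (forall x y, r x y -> s x = s y) (s \in const_spins r).
Proof.
rewrite inE; apply: (iffP 'forall_forallP) => h x y.
  by move=> rxy; apply/eqP; have := h x y; rewrite rxy.
by apply/implyP => /h ->.
Qed.

Definition flip F s : {ffun T -> bool} := [ffun x => F x (+) s x].

Lemma flipK F : involutive (flip F).
Proof. by move=> s; apply/ffunP => x; rewrite !ffunE addbA addbb. Qed.

Lemma flip_const r F s : (forall x y, r x y -> F x = F y) ->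
  (flip F s \in const_spins r) = (s \in const_spins r).
Proof.
move=> rF; apply/const_spinsP/const_spinsP => h x y rxy.
  by have := h x y rxy; rewrite !ffunE (rF _ _ rxy) => /addbI.
by rewrite !ffunE (rF _ _ rxy) (h _ _ rxy).
Qed.

Lemma const_spins_gt0 r : (0 < #|const_spins r|)%N.
Proof.
by apply/card_gt0P; exists [ffun=> true]; apply/const_spinsP => x y _; rewrite !ffunE.
Qed.

Lemma card_const_spins r (K : finType) (cl : T -> K) :
  (forall k, exists x, cl x = k) -> (forall x y, r x y = (cl x == cl y)) ->
  #|const_spins r| = (2 ^ #|K|)%N.
Proof.
move=> surj rE; pose pull (g : {ffun K -> bool}) : {ffun T -> bool} := [ffun x => g (cl x)].
have -> : const_spins r = [set pull g | g in [set: {ffun K -> bool}]].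
  apply/setP => s; apply/const_spinsP/imsetP => [h|[g _ ->] x y].
    exists [ffun k => s (sval (cid (surj k)))]; first by rewrite inE.
    apply/ffunP => x; rewrite !ffunE; apply: h; rewrite rE.
    by case: cid => y /= ->.
  by rewrite rE !ffunE => /eqP ->.
rewrite card_imset; first by rewrite cardsT card_ffun card_bool.
move=> g g' /ffunP gg'; apply/ffunP => k; have [x <-] := surj k.
by have := gg' x; rewrite !ffunE.
Qed.

Section Counting.
Variable r : rel T.
Hypotheses (r_refl : reflexive r) (r_sym : symmetric r) (r_trans : transitive r).

Let class_closed z x y : r x y -> r z x = r z y.
Proof.
move=> rxy; apply/idP/idP => h; first exact: r_trans h rxy.
by apply: r_trans h _; rewrite r_sym.
Qed.

(** Flipping the class of x exchanges s x = s y with s x <> s y. *)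
Lemma card_const_spins_eq x y : ~~ r x y ->
  #|const_spins r| = (2 * #|[set s in const_spins r | s x == s y]|)%N.
Proof.
move=> nxy; rewrite -(cardsID [set s : {ffun T -> bool} | s x == s y]) mul2n -addnn.
congr (_ + _)%N; first by apply: eq_card => s; rewrite !inE.
rewrite -(card_imset _ (inv_inj (flipK (r x)))); apply: eq_card => s.
rewrite -[s in LHS](flipK (r x)) mem_imset; last exact: inv_inj (flipK _).
rewrite finset.in_setD flip_const; last exact: class_closed.
by rewrite !inE !ffunE r_refl (negbTE nxy) andbC; case: (s x); case: (s y).
Qed.

Lemma card_const_spins_plus b :
  #|const_spins r| = (2 * #|[set s in const_spins r | s b]|)%N.
Proof.
rewrite -(cardsID [set s : {ffun T -> bool} | s b]) mul2n -addnn.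
congr (_ + _)%N; first by apply: eq_card => s; rewrite !inE.
rewrite -(card_imset _ (inv_inj (flipK predT))); apply: eq_card => s.
rewrite -[s in LHS](flipK predT) mem_imset; last exact: inv_inj (flipK _).
by rewrite finset.in_setD flip_const// !inE !ffunE andbC; case: (s b).
Qed.

(** The signs of two distinct classes are independent and uniform. *)
Lemma card_const_spins_plus2 b c : ~~ r b c ->
  #|const_spins r| = (4 * #|[set s in const_spins r | s b && s c]|)%N.
Proof.
move=> nbc; rewrite (card_const_spins_plus b) -[4%N]/(2 * 2)%N -mulnA; congr (_ * _)%N.
rewrite -(cardsID [set s : {ffun T -> bool} | s c]) mul2n -addnn.
congr (_ + _)%N; first by apply: eq_card => s; rewrite !inE andbA.
rewrite -(card_imset _ (inv_inj (flipK (r c)))); apply: eq_card => s.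
rewrite -[s in LHS](flipK (r c)) mem_imset; last exact: inv_inj (flipK _).
rewrite finset.in_setD [X in _ && X]finset.in_set flip_const; last exact: class_closed.
by rewrite !inE !ffunE r_refl r_sym (negbTE nbc); case: (s b); case: (s c); rewrite ?andbF.
Qed.

End Counting.

Definition pm (R : realType) (c : bool) : R := if c then 1 else -1.

(** Flipping every spin outside D is an involution of the index set of the sum.
    It cancels the contribution of the complement of D, so the exponents of s
    and of its image have mean h #|I :&: D|, and exp is convex. *)
Lemma exp_sum_const_spins (R : realType) (r : rel T) (D : pred T) (I : {set T}) (h : R) :
  (forall x y, r x y -> D x = D y) ->
  #|[set s in const_spins r | [forall x, D x ==> s x]]|%:R
    * expR (h * #|[set x in I | D x]|%:R)
  <= \sum_(s in const_spins r | [forall x, D x ==> s x])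
       expR (h * \sum_(x in I) pm R (s x)).
Proof.
move=> rD; set P := fun s => _ && _.
set d := #|[set x in I | D x]|; set M := fun s : {ffun T -> bool} => \sum_(x in I) pm R (s x).
have inv : \sum_(s | P s) expR (h * M s) = \sum_(s | P s) expR (h * M (flip (predC D) s)).
  rewrite (reindex_inj (inv_inj (flipK (predC D)))) /=; apply: eq_bigl => s.
  rewrite /P flip_const; last by move=> x y /rD /= ->.
  by congr (_ && _); apply: eq_forallb => x; rewrite ffunE /=; case: (D x).
have Msum s : P s -> M s + M (flip (predC D) s) = 2 * d%:R.
  move=> /andP[_ /forallP sD]; rewrite /M -big_split /=.
  rewrite (bigID D) /= [X in _ + X]big1 ?addr0; last first.
    move=> x /andP[_ nD]; rewrite ffunE /= nD /pm; case: (s x) => /=; lra.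
  transitivity (\sum_(x in [set x in I | D x]) (2 : R)).
    rewrite [RHS](eq_bigl (fun x => (x \in I) && D x)); last by move=> x; rewrite !inE.
    by apply: eq_bigr => x /andP[_ Dx]; rewrite ffunE /= Dx /=; have := sD x; rewrite Dx /= /pm => ->; lra.
  by rewrite sumr_const mulr_natr.
rewrite -(ler_pM2l (ltr0n R 2)).
have -> : 2 * (\sum_(s | P s) expR (h * M s)) =
    \sum_(s | P s) (expR (h * M s) + expR (h * M (flip (predC D) s))).
  by rewrite big_split /= -inv; ring.
rewrite mulrCA mulr_natl -sumr_const.
rewrite [X in X <= _](eq_bigl P); last by move=> s; rewrite !inE.
apply: ler_sum => s Ps; have := Msum s Ps.
set A := M s; set B := M _ => AB.
have -> : h * A = h * d%:R + h * (A - d%:R) by ring.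
have -> : h * B = h * d%:R - h * (A - d%:R).
  by rewrite (_ : B = 2 * d%:R - A); [ring|rewrite -AB; ring].
set y := h * (A - _); rewrite !expRD mulrC -mulrDr ler_wpM2l ?expR_ge0//.
by have := expR_ge1Dx y; have := expR_ge1Dx (- y); lra.
Qed.

End Spins.

(** * Clusters and the lattice condition *)

Section Connectivity.
Implicit Types (eta : edge -> bool) (x y : vertex).

Lemma connected_sym eta x y : Defs.connected eta x y -> Defs.connected eta y x.
Proof. exact: rst_sym. Qed.

Lemma connected_trans eta x y z :
  Defs.connected eta x y -> Defs.connected eta y z -> Defs.connected eta x z.
Proof. by move=> xy yz; exact: rst_trans xy yz. Qed.

Lemma connected_const (X : Type) (f : vertex -> X) eta x y :
  (forall e, eta e -> f (src e) = f (tgt e)) -> Defs.connected eta x y -> f x = f y.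
Proof.
move=> h; elim=> [u v [e [eo <- <-]]|//|u v _ ->//|u v z _ -> _ ->//].
exact: h.
Qed.

Lemma connected_edge eta (e : edge) : eta e -> Defs.connected eta (src e) (tgt e).
Proof. by move=> eo; apply: rst_step; exists e. Qed.

Lemma connected_mono eta eta' x y : (forall e, eta e -> eta' e) ->
  Defs.connected eta x y -> Defs.connected eta' x y.
Proof.
move=> h; elim=> [u v [e [/h eo <- <-]]|u|u v _|u v z _ uv _]; last exact: connected_trans.
- exact: connected_edge.
- exact: rst_refl.
- exact: connected_sym.
Qed.

End Connectivity.

Definition add_edges (D : seq edge) (eta : edge -> bool) : edge -> bool :=
  fun e => (e \in D) || eta e.

Section Clusters.
Variables (R : realType) (a : R).
Hypothesis a_gt0 : 0 < a.
Implicit Types (eta : edge -> bool) (rho : edge -> bool) (w : {ffun B a -> bool}).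

Lemma in_Q x : (x \in Q a) = `[< Qset a x >].
Proof. by rewrite in_fset_set ?inE//; exact: finite_Qset. Qed.

Lemma in_B e : (e \in B a) = `[< Qset a (src e) /\ Qset a (tgt e) >].
Proof. by rewrite in_fset_set ?inE//; exact: finite_inner_edges. Qed.

Lemma Q_val (x : Q a) : Qset a (val x).
Proof. by have := valP x; rewrite in_Q => /asboolP. Qed.

Definition crel eta : rel (Q a) := fun x y => `[< Defs.connected eta (val x) (val y) >].
Definition cspins eta := const_spins (crel eta).

Lemma crel_refl eta : reflexive (crel eta).
Proof. by move=> x; apply/asboolP; exact: rst_refl. Qed.

Lemma crel_sym eta : symmetric (crel eta).
Proof. by move=> x y; apply/asboolP/asboolP; exact: connected_sym. Qed.

Lemma crel_trans eta : transitive (crel eta).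
Proof.
move=> y x z /asboolP xy /asboolP yz; apply/asboolP.
exact: connected_trans xy yz.
Qed.

(** Clusters wander outside Q; extending the spins to the whole lattice
    reduces statements about connections to statements about single edges. *)
Lemma cspins_extend eta (s : {ffun Q a -> bool}) : s \in cspins eta ->
  exists2 f : vertex -> bool, (forall u v, Defs.connected eta u v -> f u = f v)
    & forall x : Q a, f (val x) = s x.
Proof.
move=> /const_spinsP sc.
exists (fun u => `[< exists2 x : Q a, Defs.connected eta (val x) u & s x >]) => [u v uv|x].
  apply/asboolP/asboolP => -[x xu sx]; exists x => //.
    exact: connected_trans xu uv.
  exact: connected_trans xu (connected_sym uv).
apply/asboolP/idP => [[y yx sy]|sx]; last by exists x => //; exact: rst_refl.
by rewrite -(sc y x)//; apply/asboolP.
Qed.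

Lemma cspins_ext eta eta' : (forall e, eta e = eta' e) -> cspins eta = cspins eta'.
Proof. by move=> h; congr cspins; apply/funext. Qed.

Lemma cspins_add_edge eta e (x y : Q a) : src e = val x -> tgt e = val y ->
  cspins (add_edges [:: e] eta) = [set s in cspins eta | s x == s y].
Proof.
move=> ex ey; apply/setP => s; apply/idP/idP => [/const_spinsP sc|].
  rewrite inE; apply/andP; split.
    apply/const_spinsP => u v /asboolP uv; apply/sc/asboolP.
    apply: connected_mono uv => e' e'o; apply/orP; right; exact: e'o.
  apply/eqP/sc/asboolP; rewrite -ex -ey; apply: connected_edge.
  by rewrite /add_edges inE eqxx.
rewrite inE => /andP[/cspins_extend[f fc fs] /eqP sxy].
apply/const_spinsP => u v /asboolP uv; rewrite -!fs; apply: connected_const uv => e'.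
rewrite /add_edges inE => /orP[/eqP->|/connected_edge]; last exact: fc.
by rewrite ex ey !fs.
Qed.

(** Opening an edge inside Q halves the number of spin assignments when the
    edge joins two clusters and changes nothing otherwise; in the larger
    configuration it joins two clusters less often. *)
Lemma card_cspins_add_edge eta eta' e : (forall e, eta e -> eta' e) -> e \in B a ->
  (#|cspins (add_edges [:: e] eta)| * #|cspins eta'|
     <= #|cspins (add_edges [:: e] eta')| * #|cspins eta|)%N.
Proof.
move=> le; rewrite in_B => /asboolP[Qx Qy].
have Qsrc : src e \in Q a by rewrite in_Q; apply/asboolP.
have Qtgt : tgt e \in Q a by rewrite in_Q; apply/asboolP.
pose x : Q a := [` Qsrc]%fset; pose y : Q a := [` Qtgt]%fset.
rewrite !(@cspins_add_edge _ e x y)//.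
have split_card xi : #|cspins xi| =
    ((~~ crel xi x y).+1 * #|[set s in cspins xi | s x == s y]|)%N.
  case: (boolP (crel xi x y)) => [xy|] /=; last first.
    move=> nxy; apply: card_const_spins_eq => //; [exact: crel_refl|exact: crel_sym|exact: crel_trans].
  rewrite mul1n; apply: eq_card => s; rewrite inE andb_idr// => /const_spinsP sc.
  by apply/eqP/sc.
rewrite (split_card eta) (split_card eta').
have : (~~ crel eta' x y <= ~~ crel eta x y)%N.
  have : crel eta x y -> crel eta' x y.
    by move=> /asboolP xy; apply/asboolP; exact: connected_mono xy.
  by case: crel => [->|]//; case: crel.
by move=> h; rewrite mulnCA mulnC [X in (_ <= X)%N]mulnCA [X in (_ <= X)%N]mulnC; nia.
Qed.

Lemma card_cspins_add_edges eta eta' D : (forall e, eta e -> eta' e) ->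
  {subset D <= B a} ->
  (#|cspins (add_edges D eta)| * #|cspins eta'|
     <= #|cspins (add_edges D eta')| * #|cspins eta|)%N.
Proof.
move=> le; elim: D => [|e D IH] DB; first by rewrite mulnC.
have addE xi : cspins (add_edges (e :: D) xi) = cspins (add_edges [:: e] (add_edges D xi)).
  by apply: cspins_ext => e'; rewrite /add_edges !inE orbA.
have IH' : _ := IH (fun e' De' => DB e' (mem_behead (s := e :: D) De')).
have le' e' : add_edges D eta e' -> add_edges D eta' e'.
  by move=> /orP[h|/le h]; apply/orP; [left|right].
have h1 := card_cspins_add_edge le' (DB e (mem_head _ _)).
have p1 := const_spins_gt0 (crel (add_edges D eta)).
have p2 := const_spins_gt0 (crel (add_edges D eta')).
rewrite !addE; rewrite -/(cspins _) in p1 p2.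
rewrite -(leq_pmul2l p1) -(leq_pmul2l p2).
have := leq_mul h1 IH'.
rewrite !mulnA; set A1 := #|cspins (add_edges [:: e] (add_edges D eta))|.
set A2 := #|cspins (add_edges [:: e] (add_edges D eta'))|.
by move: (A1) (A2) (#|cspins (add_edges D eta)|) (#|cspins (add_edges D eta')|) (#|cspins eta|) (#|cspins eta'|) => b1 b2 n1 n2 m1 m2; rewrite [X in (X <= _)%N -> _](_ : _ = n2 * n1 * b1 * m2)%N ?[X in (_ <= X)%N -> _](_ : _ = n2 * n1 * b2 * m1)%N//; ring.
Qed.

Lemma glueT rho w (e : B a) : Defs.glue rho w (val e) = w e.
Proof. by rewrite /Defs.glue valK. Qed.

Lemma glueF rho w e : e \notin B a -> Defs.glue rho w e = rho e.
Proof. by move=> h; rewrite /Defs.glue insubN. Qed.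

Lemma glue_eq rho w e : Defs.glue rho w e = if insub e is Some e' then w e' else rho e.
Proof. by []. Qed.

(** The lattice condition for 2^(number of clusters), between two ordered
    boundary conditions: starting from the meet and from v, open the edges of
    u. *)
Lemma cspins_lattice rho rho' (u v : {ffun B a -> bool}) :
  (forall e, rho e -> rho' e) ->
  (#|cspins (Defs.glue rho u)| * #|cspins (Defs.glue rho' v)|
   <= #|cspins (Defs.glue rho' (join u v))| * #|cspins (Defs.glue rho (meet u v))|)%N.
Proof.
move=> le; pose D : seq edge := [seq val e | e <- enum [pred e : B a | u e]].
have DB : {subset D <= B a} by move=> e /mapP[e' _ ->]; exact: valP.
have inD (e : B a) : (val e \in D) = u e by rewrite mem_map ?mem_enum//; exact: val_inj.
have split e : (exists e' : B a, e = val e') \/ e \notin B a.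
  by case: (boolP (e \in B a)) => [h|]; [left; exists [` h]%fset|right].
rewrite (@cspins_ext (Defs.glue rho u) (add_edges D (Defs.glue rho (meet u v)))); last first.
  move=> e; rewrite /add_edges; case: (split e) => [[e' ->]|nB].
    by rewrite inD !glueT ffunE; case: (u e').
  by rewrite !glueF// (negbTE (contra (DB e) nB)).
rewrite (@cspins_ext (Defs.glue rho' (join u v)) (add_edges D (Defs.glue rho' v))); last first.
  move=> e; rewrite /add_edges; case: (split e) => [[e' ->]|nB].
    by rewrite inD !glueT ffunE.
  by rewrite !glueF// (negbTE (contra (DB e) nB)).
apply: card_cspins_add_edges => // e; case: (split e) => [[e' ->]|nB].
  by rewrite !glueT ffunE => /andP[].
by rewrite !glueF//; exact: le.
Qed.

(** A spin assignment constant on clusters is a sign for each cluster. *)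
Lemma card_clusters rho w : (2 ^ #|` clusters a rho w|)%N = #|cspins (Defs.glue rho w)|.
Proof.
have clP (x : Q a) : Defs.cluster (Defs.glue rho w) (val x) \in clusters a rho w.
  by apply/in_clusters => //; exists (val x) => //; exact: Q_val.
rewrite (@card_const_spins _ _ _ (fun x : Q a => [` clP x]%fset)) ?cardfE//.
  move=> [C Cc]; have /(in_clusters _ _ _ a_gt0)[x Qx Cx] := Cc.
  have Qx' : x \in Q a by rewrite in_Q; apply/asboolP.
  by exists [` Qx']%fset; apply/val_inj => /=.
move=> x y; apply/asboolP/eqP => [xy|/(congr1 val) /= h].
  apply/val_inj/seteqP; split => z /= xz; last exact: connected_trans xy xz.
  exact: connected_trans (connected_sym xy) xz.
have : Defs.cluster (Defs.glue rho w) (val y) (val y) by exact: rst_refl.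
by rewrite -h.
Qed.

Lemma csizeE (C : set vertex) : csize a C = #|[set x : Q a | `[< C (val x) >]]|.
Proof.
rewrite /csize cardE -(size_map val) -[LHS]/(size (enum_fset _)).
apply/perm_size/uniq_perm; first exact: fset_uniq.
  by rewrite map_inj_uniq ?enum_uniq//; exact: val_inj.
move=> z; have fC : finite_set (C `&` Qset a)%classic.
  by apply: sub_finite_set (finite_Qset a_gt0) => ? [].
rewrite (in_fset_set fC); apply/idP/mapP; rewrite in_setE.
  move=> [Cz Qz]; have Qz' : z \in Q a by rewrite in_Q; apply/asboolP.
  by exists [` Qz']%fset => //; rewrite mem_enum inE; exact/asboolP.
by move=> [x]; rewrite mem_enum inE => /asboolP Cx ->; split => //; exact: Q_val.
Qed.

End Clusters.

(** * Domination by the wired measure *)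

Section Domination.
Variables (R : realType) (a : R).
Hypothesis a_gt0 : 0 < a.
Implicit Types (rho : edge -> bool) (w : {ffun B a -> bool}).

Lemma beta_c_gt0 : 0 < beta_c R.
Proof.
by rewrite divr_gt0// ln_gt0// ltrDl sqrtr_gt0.
Qed.

Definition p_open : R := 1 - expR (- (2 * beta_c R)).
Definition p_closed : R := expR (- (2 * beta_c R)).
Definition bond w : R := \prod_e (if w e then p_open else p_closed).

Lemma p_open_gt0 : 0 < p_open.
Proof. by rewrite subr_gt0 expR_lt1 oppr_lt0 mulr_gt0// beta_c_gt0. Qed.

Lemma bond_gt0 w : 0 < bond w.
Proof. by apply: prodr_gt0 => e _; case: ifP => _; [exact: p_open_gt0|exact: expR_gt0]. Qed.

Lemma fk_weightE rho w :
  fk_weight rho w = #|cspins a (Defs.glue rho w)|%:R * bond w :> R.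
Proof.
rewrite -card_clusters// natrX /fk_weight -mulrA; congr (_ * _).
rewrite /bond (bigID (fun e => w e)) /=; congr (_ * _).
  rewrite (eq_bigr (fun=> p_open)); last by move=> e ->.
  by rewrite prodr_const.
rewrite (eq_bigr (fun=> p_closed)); last by move=> e /negbTE ->.
by rewrite prodr_const.
Qed.

Lemma fk_weight_gt0 rho w : 0 < fk_weight rho w :> R.
Proof. by rewrite fk_weightE mulr_gt0 ?bond_gt0// ltr0n const_spins_gt0. Qed.

Lemma bond_join_meet u v : bond u * bond v = bond (join u v) * bond (meet u v).
Proof.
rewrite /bond -!big_split /=; apply: eq_bigr => e _; rewrite !ffunE.
by case: (u e); case: (v e) => //=; rewrite mulrC.
Qed.

Definition max_csize rho w : nat := \max_(C <- clusters a rho w) csize a C.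

Lemma max_csize_mono rho rho' u v :
  (forall e, Defs.glue rho u e -> Defs.glue rho' v e) ->
  (max_csize rho u <= max_csize rho' v)%N.
Proof.
move=> le; apply/bigmax_leqP_seq => C /(in_clusters _ _ _ a_gt0)[x Qx ->] _.
apply: (@leq_trans (csize a (Defs.cluster (Defs.glue rho' v) x))).
  rewrite !csizeE//; apply/subset_leq_card/fintype.subsetP => y; rewrite !finset.in_set.
  by move=> /asboolP xy; apply/asboolP; exact: connected_mono le xy.
apply: (@leq_bigmax_seq _ _ xpredT) => //.
by apply/in_clusters => //; exists x.
Qed.

(** Stochastic domination by the wired measure, through the four functions
    theorem applied to the two weights and the two weighted observables. *)
Lemma fk_E_le_wired rho (t : R) : 0 <= t ->
  fk_E a rho (fun w => expR (t * Amax a rho w))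
    <= fk_E a wired (fun w => expR (t * Amax a wired w)).
Proof.
move=> t0; rewrite /fk_E /gibbs.
have Zgt0 r : 0 < \sum_w fk_weight (a := a) r w :> R.
  rewrite (bigD1 [ffun=> true])//= ltr_wpDr ?fk_weight_gt0//.
  by apply: sumr_ge0 => w _; exact/ltW/fk_weight_gt0.
rewrite ler_pdivrMr// mulrAC ler_pdivlMr//.
apply: four_functions => [w|w|w|w|u v]; try exact/ltW/fk_weight_gt0;
  try by apply: mulr_ge0; rewrite ?expR_ge0// ltW// fk_weight_gt0.
rewrite !fk_weightE.
set nu := #|cspins a (Defs.glue rho u)|; set nv := #|_|; set nj := #|cspins a (Defs.glue wired _)|.
set nm := #|_|.
have lat : (nu * nv <= nj * nm)%N by exact: cspins_lattice.
have expo : expR (t * Amax a rho u) <= expR (t * Amax a wired (join u v)).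
  rewrite ler_expR ler_wpM2l// ler_wpM2l ?powR_ge0// ler_nat.
  apply: max_csize_mono => e; rewrite !glue_eq; case: insub => // e'.
  by rewrite ffunE => ->.
have -> : nu%:R * bond u * expR (t * Amax a rho u) * (nv%:R * bond v) =
    (nu * nv)%:R * (bond u * bond v) * expR (t * Amax a rho u) by rewrite natrM; ring.
have -> : nj%:R * bond (join u v) * expR (t * Amax a wired (join u v)) *
      (nm%:R * bond (meet u v)) =
    (nj * nm)%:R * (bond u * bond v) * expR (t * Amax a wired (join u v)).
  by rewrite natrM bond_join_meet; ring.
have bb : 0 <= bond u * bond v by rewrite mulr_ge0// ltW// bond_gt0.
apply: ler_pM expo; rewrite ?expR_ge0 ?mulr_ge0 ?ler0n// ?(ltW (bond_gt0 _))//.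
by apply: ler_wpM2r => //; rewrite ler_nat.
Qed.

End Domination.

(** * The Edwards-Sokal coupling on the square without its shell *)

Definition box (n : nat) : set vertex :=
  [set x : vertex | (`|x.1| <= n)%N /\ (`|x.2| <= n)%N].

Lemma big_fset_subset (R : nmodType) (K : choiceType) (A C : {fset K}) (F : K -> R) :
  {subset A <= C} -> \sum_(x <- C | x \in A) F x = \sum_(x <- A) F x.
Proof.
move=> AC; rewrite -big_filter; apply: perm_big; apply: uniq_perm.
- by rewrite filter_uniq// fset_uniq.
- exact: fset_uniq.
- by move=> x; rewrite mem_filter andb_idr// => /AC.
Qed.

Section EdwardsSokal.
Variables (R : realType) (a a' : R) (n : nat).
Hypotheses (a_gt0 : 0 < a) (a'_gt0 : 0 < a').
Hypotheses (Qa : Qset a = box n.+1) (Qa' : Qset a' = box n).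
Implicit Types (w : {ffun B a -> bool}) (s : {ffun Q a' -> bool}).

Lemma edge_step (e : edge) :
  (box n (src e) -> box n.+1 (tgt e)) /\ (box n (tgt e) -> box n.+1 (src e)).
Proof. by case: e => [[i j] []]; rewrite /box /src /tgt /=; lia. Qed.

Lemma notin_B_outer (e : edge) : e \notin B a ->
  ~ Qset a' (src e) /\ ~ Qset a' (tgt e).
Proof.
rewrite in_B// => /asboolPn; rewrite Qa Qa' => h; have [st ts] := edge_step e.
have sub x : box n x -> box n.+1 x by case: x => i j; rewrite /box /=; lia.
by split=> [x|x]; apply: h; [split; [exact: sub|exact: st]|split; [exact: ts|exact: sub]].
Qed.

Lemma in_Bbar (e : edge) : (e \in Bbar a') = `[< Qset a' (src e) \/ Qset a' (tgt e) >].
Proof. by rewrite in_fset_set ?inE//; exact: finite_touching_edges. Qed.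

Lemma Bbar_sub : {subset Bbar a' <= B a}.
Proof.
move=> e; rewrite in_Bbar => /asboolP h; apply/negPn/negP => /notin_B_outer[? ?].
by case: h.
Qed.

(** Vertices of Q outside the smaller square have a neighbour outside Q, hence
    all belong to the boundary cluster. *)
Lemma outer_connected w x y : Qset a x -> Qset a y -> ~ Qset a' x -> ~ Qset a' y ->
  Defs.connected (Defs.glue wired w) x y.
Proof.
have bd z : Qset a z -> ~ Qset a' z -> inner_boundary a z.
  rewrite Qa Qa'; case: z => i j [/= hi hj] out; split; first by rewrite Qa.
  rewrite Qa; have [hni|hni] := ltnP n `|i|%N.
    have [i0|i0] := leP 0 i.
      by exists (i + 1, j); [exists ((i, j), true); left|rewrite /box /=; lia].
    exists (i - 1, j); last by rewrite /box /=; lia.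
    by exists ((i - 1, j), true); right; rewrite /src /tgt /= subrK.
  have hnj : (n < `|j|)%N by rewrite ltnNge; apply/negP => ?; exact: out.
  have [j0|j0] := leP 0 j.
    by exists (i, j + 1); [exists ((i, j), false); left|rewrite /box /=; lia].
  exists (i, j - 1); last by rewrite /box /=; lia.
  by exists ((i, j - 1), false); right; rewrite /src /tgt /= subrK.
move=> Qx Qy nx ny; have [C [[/(in_clusters _ _ _ a_gt0)[z _ ->] sub] _]] := boundary_cluster_unique w a_gt0.
exact: connected_trans (connected_sym (sub _ (bd _ Qx nx))) (sub _ (bd _ Qy ny)).
Qed.

Definition bspin s (x : vertex) : bool := if insub x is Some x' then s x' else true.

Lemma spin_pm s x : spin s x = pm R (bspin s x).
Proof. by rewrite /spin /bspin; case: insub. Qed.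

Lemma bspin_out s x : ~ Qset a' x -> bspin s x = true.
Proof.
by move=> h; rewrite /bspin insubN//= in_Q//; apply/asboolPn.
Qed.

Lemma Q_sub x : x \in Q a' -> x \in Q a.
Proof.
rewrite !in_Q// => /asboolP; rewrite Qa Qa' => h; apply/asboolP.
by case: x h => i j; rewrite /box /=; lia.
Qed.

Definition extend s : {ffun Q a -> bool} := [ffun x => bspin s (val x)].
Definition restrict (r : {ffun Q a -> bool}) : {ffun Q a' -> bool} :=
  [ffun x => r [` Q_sub (valP x)]%fset].

Lemma extendK : cancel extend restrict.
Proof.
by move=> s; apply/ffunP => x; rewrite !ffunE /= /bspin valK.
Qed.

Definition compatible s w :=
  [forall e : B a, w e ==> (bspin s (src (val e)) == bspin s (tgt (val e)))].

(** Spins constant on wired clusters with sign + at one boundary vertex are +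
    on the whole shell, so they are the plus extensions of spins on the
    smaller square, and being constant on clusters amounts to agreeing along
    every open edge of Q. *)
Lemma sum_cspins_extend w (b : Q a) (F : {ffun Q a -> bool} -> R) : ~ Qset a' (val b) ->
  \sum_(r in cspins a (Defs.glue wired w) | r b) F r =
  \sum_(s | compatible s w) F (extend s).
Proof.
move=> nb; have fixed r : (r \in cspins a (Defs.glue wired w)) && r b ->
    extend (restrict r) = r.
  case/andP=> /const_spinsP rc rb; apply/ffunP => x; rewrite !ffunE /bspin.
  case: insubP => [x' _ xx'|]; first by rewrite ffunE; congr (r _); apply/val_inj.
  rewrite in_Q// => /asboolPn nx; rewrite -rb; apply/rc/asboolP.
  by apply: outer_connected => //; exact: Q_val.
rewrite (reindex_onto extend restrict)//; apply: eq_bigl => s.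
rewrite extendK eqxx andbT ffunE bspin_out// andbT.
apply/const_spinsP/forallP => [sc e|sc x y /asboolP xy].
  apply/implyP => we; have := valP e; rewrite in_B// => /asboolP[Qs Qt].
  have hs : src (val e) \in Q a by rewrite in_Q//; apply/asboolP.
  have ht : tgt (val e) \in Q a by rewrite in_Q//; apply/asboolP.
  have := sc [` hs]%fset [` ht]%fset; rewrite !ffunE /= => -> //.
  by apply/asboolP; apply: connected_edge; rewrite glueT.
rewrite !ffunE; apply: connected_const xy => e eo.
case: (boolP (e \in B a)) => [eB|/notin_B_outer[? ?]]; last by rewrite !bspin_out.
have := sc [` eB]%fset; move: eo; rewrite -[e]/(val [` eB]%fset) glueT => -> /=.
by move/eqP.
Qed.

(** The edges of Q joining two shell vertices carry the energy 1 whatever the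
    spins are, and each edge factor of the coupling is
    exp (beta_c (s s' - 1)). *)
Definition es_const : R :=
  expR (beta_c R * (\sum_(e <- B a | e \notin Bbar a') 1 - \sum_(e : B a) 1)).

(** Summing out the edges factorises: an edge whose end spins agree gives
    p + (1 - p) = 1, the others 1 - p = exp (- 2 beta_c). *)
Lemma sum_bond_compatible s :
  \sum_(w | compatible s w) bond w = es_const * ising_plus_weight s.
Proof.
pose agree (e : edge) := bspin s (src e) == bspin s (tgt e).
pose F (e : B a) (c : bool) : R := if c then p_open R * (agree (val e))%:R else p_closed R.
transitivity (\sum_(w : {ffun B a -> bool}) \prod_e F e (w e)).
  rewrite big_mkcond /=; apply: eq_bigr => w _; case: ifP => [/forallP sw|/negbT].
    apply: eq_bigr => e _; rewrite /F; have := sw e.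
    by case: (w e) => //=; rewrite /agree => ->; rewrite mulr1.
  rewrite negb_forall => /existsP[e]; rewrite negb_imply => /andP[we nae].
  by rewrite (bigD1 e)//= /F we /agree (negbTE nae) mulr0 mul0r.
rewrite -(bigA_distr_bigA F) /=.
transitivity (\prod_(e : B a) expR (beta_c R * (spin s (src (val e)) * spin s (tgt (val e)) - 1))).
  apply: eq_bigr => e _; rewrite big_bool /= /F /agree /p_open /p_closed !spin_pm /pm.
  case: (bspin s (src _)); case: (bspin s (tgt _)) => /=;
    rewrite ?mulr1 ?mulr0 ?mulrN1 ?opprK ?subrr ?mulr0 ?expR0 ?add0r; try ring.
    by congr expR; ring.
  by congr expR; ring.
rewrite -expR_sum -mulr_sumr sumrB /es_const /ising_plus_weight -expRD.
congr expR; rewrite -mulrDr; congr (_ * _).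
rewrite -[X in X - _ = _](big_seq_fsetE _ _ (fun=> true) (fun e => spin s (src e) * spin s (tgt e))) /=.
rewrite (bigID (fun e => e \in Bbar a')) /= (big_fset_subset _ Bbar_sub).
rewrite [X in _ + X - _](eq_bigr (fun=> 1)); first by ring.
move=> e; rewrite in_Bbar => /asboolPn ne; rewrite !spin_pm !bspin_out ?mulr1//; tauto.
Qed.

Definition inner : {set Q a} := [set x | val x \in Q a'].

Lemma sum_inner_extend s :
  \sum_(x in inner) pm R (extend s x) = \sum_(x <- Q a') spin s x.
Proof.
rewrite -(big_fset_subset _ Q_sub) big_seq_fsetE /=.
by apply: eq_big => x; [rewrite inE|move=> _; rewrite ffunE spin_pm].
Qed.

(** If the largest cluster is that of b, keep it + and flip the others: its
    vertices in the shell cost the exponential factor. Otherwise it avoids the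
    shell, and it is + for half of the assignments. *)
Lemma max_csize_spins (b : Q a) w (h : R) : 0 <= h -> ~ Qset a' (val b) ->
  #|cspins a (Defs.glue wired w)|%:R * expR (h * (max_csize wired w)%:R) <=
  Num.max 2 (expR (h * #|~: inner|%:R)) *
  (2 * \sum_(r in cspins a (Defs.glue wired w) | r b)
         expR (h * \sum_(x in inner) pm R (r x))).
Proof.
move=> h0 nb; pose r : rel (Q a) := crel (Defs.glue wired w).
have [x maxE] : exists x, (max_csize wired w <= #|[set y | r x y]|)%N.
  case: (@arg_maxnP _ b xpredT (fun x => #|[set y | r x y]|)) => // x _ xmax.
  exists x; apply/bigmax_leqP_seq => C /(in_clusters _ _ _ a_gt0)[z Qz ->] _.
  have Qz' : z \in Q a by rewrite in_Q//; apply/asboolP.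
  rewrite csizeE//; exact: xmax [` Qz']%fset isT.
have rr : reflexive r := crel_refl _.
have rs : symmetric r := @crel_sym _ _ _.
have rt : transitive r := @crel_trans _ _ _.
set S := \sum_(_ in _ | _) _.
have cl z u v : r u v -> r z u = r z v.
  move=> uv; apply/idP/idP => zu; first exact: rt zu uv.
  by apply: rt zu _; rewrite rs.
have S0 : 0 <= S by apply: sumr_ge0 => *; exact: expR_ge0.
have exp_max : expR (h * (max_csize wired w)%:R) <= expR (h * #|[set y | r x y]|%:R).
  by rewrite ler_expR ler_wpM2l// ler_nat.
apply: (@le_trans _ _ (#|cspins a (Defs.glue wired w)|%:R * expR (h * #|[set y | r x y]|%:R))).
  by rewrite ler_wpM2l.
case: (boolP (r b x)) => bx.
  (* The largest cluster is the boundary cluster: D is the class of b. *)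
  have := exp_sum_const_spins inner h (cl b).
  rewrite (_ : \sum_(s in const_spins r | _) _ = S); last first.
    apply: eq_bigl => s; case: (boolP (s \in const_spins r)) => //= /const_spinsP sc.
    apply/forallP/idP => [/(_ b)|sb y]; first by rewrite rr.
    by apply/implyP => /sc <-.
  rewrite [X in X%:R * _ <= _](_ : _ = #|[set s in const_spins r | s b]|); last first.
    apply: eq_card => s; rewrite [LHS]finset.in_set [RHS]finset.in_set; case: (boolP (s \in const_spins r)) => //= /const_spinsP sc.
    apply/forallP/idP => [/(_ b)|sb y]; first by rewrite rr.
    by apply/implyP => /sc <-.
  set d := #|[set _ in inner | _]|; set m := #|_| => mS.
  have -> : #|cspins a (Defs.glue wired w)| = (2 * m)%N by exact: card_const_spins_plus.
  have le : (#|[set y | r x y]| <= d + #|~: inner|)%N.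
    apply: leq_trans (leq_card_setU _ _); apply/subset_leq_card/fintype.subsetP => y.
    rewrite finset.in_set finset.in_setU [X in X || _]finset.in_set finset.in_setC => xy.
    by rewrite (rt _ _ _ bx xy) andbT orbN.
  have le' : expR (h * #|[set y | r x y]|%:R) <= expR (h * d%:R) * expR (h * #|~: inner|%:R).
    by rewrite -expRD -mulrDr -natrD ler_expR ler_wpM2l// ler_nat.
  apply: (@le_trans _ _ ((2 * m)%:R * (expR (h * d%:R) * expR (h * #|~: inner|%:R)))).
    by rewrite ler_wpM2l.
  apply: (@le_trans _ _ (expR (h * #|~: inner|%:R) * (2 * S))).
    rewrite natrM; have := ler_wpM2l (expR_ge0 (h * #|~: inner|%:R)) mS; nra.
  by rewrite ler_wpM2r ?mulr_ge0// le_max lexx orbT.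
(* Otherwise D is the union of the classes of b and x. *)
have cl2 u v : r u v -> r b u || r x u = r b v || r x v.
  by move=> uv; rewrite (cl b _ _ uv) (cl x _ _ uv).
have := exp_sum_const_spins inner h cl2.
set S' := \sum_(_ in _ | _) _; set d := #|[set _ in inner | _]|.
have DE u : u \in const_spins r -> [forall y, (r b y || r x y) ==> u y] = u b && u x.
  move=> /const_spinsP sc; apply/forallP/andP => [sD|[sb sx] y].
    by split; [have := sD b|have := sD x]; rewrite rr ?orbT.
  by apply/implyP => /orP[] /sc <-.
rewrite [X in X%:R * _ <= _](_ : _ = #|[set s in const_spins r | s b && s x]|); last first.
  apply: eq_card => s; rewrite [LHS]finset.in_set [RHS]finset.in_set; case: (boolP (s \in const_spins r)) => //= sc.
  exact: DE.
set m := #|_| => mS.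
have -> : #|cspins a (Defs.glue wired w)| = (4 * m)%N by exact: card_const_spins_plus2.
have SS : S' <= S.
  rewrite /S' /S [X in X <= _]big_mkcond [X in _ <= X]big_mkcond /=.
  apply: ler_sum => s _; rewrite -/r; case: (boolP (s \in const_spins r)) => //= /DE ->.
  by case: (s b) => //=; case: ifP; rewrite ?expR_ge0.
have le : (#|[set y | r x y]| <= d)%N.
  apply/subset_leq_card/fintype.subsetP => y; rewrite finset.in_set => xy.
  rewrite finset.in_set xy orbT andbT; apply: contraNT bx => ny; apply: (rt y); last by rewrite rs.
  apply/asboolP; apply: outer_connected => //; try exact: Q_val.
  by move: ny; rewrite finset.in_set in_Q// => /asboolPn.
have le' : expR (h * #|[set y | r x y]|%:R) <= expR (h * d%:R).
  by rewrite ler_expR ler_wpM2l// ler_nat.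
apply: (@le_trans _ _ (2 * (2 * S))); last first.
  by rewrite ler_wpM2r ?mulr_ge0// le_max lexx.
have : m%:R * expR (h * #|[set y | r x y]|%:R) <= S.
  by apply: le_trans SS; apply: le_trans mS; rewrite ler_wpM2l.
by rewrite natrM; nra.
Qed.

(** Both partition functions and both numerators are sums over pairs of edge
    and spin configurations; they are compared edge configuration by edge
    configuration, and the spins are kept after summing out the edges. *)
Theorem wired_le_ising (b : Q a) (h : R) : 0 <= h -> ~ Qset a' (val b) ->
  fk_E a wired (fun w => expR (h * (max_csize wired w)%:R)) <=
  Num.max 2 (expR (h * #|~: inner|%:R)) *
  ising_plus_E a' (fun s => expR (h * \sum_(x <- Q a') spin s x)).
Proof.
move=> h0 nb; rewrite /fk_E /ising_plus_E /gibbs; set X := Num.max _ _.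
have swap (G : {ffun Q a' -> bool} -> R) :
    \sum_w bond w * \sum_(s | compatible s w) G s =
    es_const * \sum_s ising_plus_weight s * G s.
  rewrite mulr_sumr; transitivity (\sum_w \sum_s if compatible s w then bond w * G s else 0).
    by apply: eq_bigr => w _; rewrite mulr_sumr big_mkcond.
  rewrite exchange_big /=; apply: eq_bigr => s _.
  rewrite -big_mkcond /= -mulr_suml sum_bond_compatible; ring.
have Zfk : \sum_w fk_weight (a := a) wired w = 2 * (es_const * \sum_s ising_plus_weight (a := a') s).
  have -> : \sum_s ising_plus_weight (a := a') s = \sum_s ising_plus_weight (a := a') s * 1.
    by apply: eq_bigr => s _; rewrite mulr1.
  rewrite -swap mulr_sumr; apply: eq_bigr => w _; rewrite fk_weightE//.
  rewrite -(sum_cspins_extend w (fun=> 1) nb) sumr_const.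
  have -> : #|cspins a (Defs.glue wired w)| = (2 * #|[set r in cspins a (Defs.glue wired w) | r b]|)%N.
    by apply: card_const_spins_plus.
  rewrite natrM -[LHS]mulrA; congr (_ * _); rewrite [LHS]mulrC; congr (_ * _%:R).
  by apply: eq_card => u; rewrite finset.in_set.
have Zpos : 0 < \sum_s ising_plus_weight (a := a') s.
  rewrite (bigD1 [ffun=> true])//= ltr_wpDr ?expR_gt0//.
  by apply: sumr_ge0 => s _; exact: expR_ge0.
have cpos : 0 < es_const by exact: expR_gt0.
rewrite Zfk ler_pdivrMr ?mulr_gt0//.
move: Zpos; set Z := \sum_s _; set A := \sum_s ising_plus_weight s * _ => Zpos.
have -> : X * (A / Z) * (2 * (es_const * Z)) = X * (2 * (es_const * A)).
  by field; rewrite gt_eqF.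
rewrite /A -swap !mulr_sumr; apply: ler_sum => w _; rewrite fk_weightE//.
have := max_csize_spins w h0 nb; rewrite -/X => /(ler_wpM2l (ltW (bond_gt0 w))).
rewrite (sum_cspins_extend w _ nb).
rewrite (eq_bigr (fun s => expR (h * \sum_(x <- Q a') spin s x))); last first.
  by move=> s _; rewrite sum_inner_extend.
by nra.
Qed.

End EdwardsSokal.

(** * Explicit computations and the choice of scales *)

Lemma pow158 (R : realType) (x : R) : 0 <= x -> (x `^ (15 / 8)) ^+ 8 = x ^+ 15.
Proof.
move=> x0; rewrite -powR_mulrn ?powR_ge0// -powRrM -[RHS]powR_mulrn//.
by congr (_ `^ _); field.
Qed.

(** Reduces bounds on x^(15/8) to polynomial ones. *)
Lemma pow158_le (R : realType) (x y : R) : 0 <= x -> 0 <= y -> x ^+ 15 <= y ^+ 8 ->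
  x `^ (15 / 8) <= y.
Proof. by move=> x0 y0; rewrite -pow158// ler_pXn2r// nnegrE powR_ge0. Qed.

(** From exp (- x) >= (1 - x / 8)^8. *)
Lemma expR_065 (R : realType) : expR (65 / 100) <= 2 :> R.
Proof.
have below (x : R) : 0 <= 1 - x -> (1 - x) ^+ 8 <= expR (8%:R * - x).
  by move=> x1; rewrite expRM_natl; apply: lerXn2r; rewrite ?nnegrE ?expR_ge0 ?expR_ge1Dx.
have h8 : (1 - 65 / 800) ^+ 8 <= expR (- (65 / 100)) :> R.
  rewrite (_ : - (65 / 100) = 8%:R * - (65 / 800) :> R); last by field.
  by apply: below; lra.
have p8 : 1 / 2 <= (1 - 65 / 800) ^+ 8 :> R by lra.
rewrite -[65 / 100 in X in X <= _]opprK expRN -[2]invrK lef_pV2 ?posrE ?expR_gt0//.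
by apply: le_trans h8; apply: le_trans p8; rewrite div1r.
Qed.

Lemma Qset_box (R : realType) (a : R) (n : nat) : 0 < a ->
  n%:R <= 1 / 2 / a < n.+1%:R -> Qset a = box n.
Proof.
move=> a0 /andP[na an]; have key (i : int) : (`|a * i%:~R| <= 1 / 2) = (`|i| <= n)%N.
  rewrite normrM gtr0_norm// mulrC -ler_pdivlMr// -intr_norm -natr_absz.
  apply/idP/idP => h; last by apply: le_trans na; rewrite ler_nat.
  by rewrite -ltnS -(ltr_nat R); apply: le_lt_trans h an.
by apply/seteqP; split => x; rewrite /Qset /= !key.
Qed.

Lemma half_side_exists (R : realType) (a : R) : 0 < a ->
  exists n : nat, n%:R <= 1 / 2 / a < n.+1%:R.
Proof.
move=> a0; exists (Num.truncn (1 / 2 / a)).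
by apply: truncn_itv; rewrite !divr_ge0// ltW.
Qed.

Lemma box_succ_boundary (n : nat) : box n.+1 (n.+1%:Z, 0) /\ ~ box n (n.+1%:Z, 0).
Proof. by rewrite /box /=; split; lia. Qed.

Section Box.
Variables (R : realType) (a : R) (n : nat).
Hypotheses (a_gt0 : 0 < a) (Qa : Qset a = box n).

Lemma card_Q : #|` Q a| = ((2 * n).+1 ^ 2)%N.
Proof.
pose g (p : 'I_(2 * n).+1 * 'I_(2 * n).+1) : vertex := (p.1%:Z - n%:Z, p.2%:Z - n%:Z).
have ginj : injective g.
  move=> [p1 p2] [q1 q2] [e1 e2]; congr pair; apply/val_inj => /=; lia.
transitivity (size [seq g p | p <- enum {: 'I_(2 * n).+1 * 'I_(2 * n).+1}]); last first.
  by rewrite size_map -cardE card_prod !card_ord.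
apply/perm_size/uniq_perm; first exact: fset_uniq.
  by rewrite map_inj_uniq ?enum_uniq.
move=> x; rewrite in_Q// Qa; apply/asboolP/mapP => [|[[p q] _ ->]].
  case: x => i j [/= hi hj].
  have pi : (absz (i + n%:Z)%R < (2 * n).+1)%N by lia.
  have pj : (absz (j + n%:Z)%R < (2 * n).+1)%N by lia.
  exists (Ordinal pi, Ordinal pj); first by rewrite mem_enum.
  by rewrite /g /=; congr pair; lia.
by have := ltn_ord p; have := ltn_ord q; rewrite /g /box /=; lia.
Qed.

End Box.

Lemma card_shell (R : realType) (a a' : R) (n : nat) : 0 < a -> 0 < a' ->
  Qset a = box n.+1 -> Qset a' = box n -> #|~: inner a a'| = (8 * n.+1)%N.
Proof.
move=> a0 a'0 Qa Qa'; have := cardsC (inner a a').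
have -> : #|inner a a'| = #|` Q a'|.
  transitivity (csize a (Qset a')).
    by rewrite csizeE//; apply: eq_card => x; rewrite !finset.in_set in_Q.
  rewrite /csize /Q; congr #|` fset_set _|; apply/seteqP; split => [x []//|x Qx].
  split=> //; move: Qx; rewrite Qa Qa'; case: x => i j; rewrite /box /=; lia.
rewrite -cardfE (card_Q a0 Qa) (card_Q a'0 Qa') !expnS !expn0; lia.
Qed.

Section SingleVertex.
Variables (R : realType) (a t : R).
Hypotheses (a_gt0 : 0 < a) (Qa : Qset a = box 0).

Let o : vertex := (0, 0).

Lemma Qset0 x : Qset a x <-> x = o.
Proof.
by rewrite Qa /o; split => [|->//]; case: x => i j [/= *]; congr pair; lia.
Qed.

(** Four edges join the only vertex to the plus boundary. *)
Lemma ising_single (E4 := 4 * beta_c R) (u := t * a `^ (15 / 8)) :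
  ising_plus_E a (fun s => expR (t * magnetization a s)) =
  (expR E4 * expR u + expR (- E4) * expR (- u)) / (expR E4 + expR (- E4)).
Proof.
have oQ : o \in Q a by rewrite in_Q//; apply/asboolP/Qset0.
pose c (b : bool) : {ffun Q a -> bool} := [ffun=> b].
have Qo (x : Q a) : x = [` oQ]%fset by apply/val_inj/Qset0; exact: Q_val.
have sumc (F : {ffun Q a -> bool} -> R) : \sum_s F s = F (c true) + F (c false).
  rewrite (reindex c); first by rewrite big_bool.
  exists (fun s : {ffun Q a -> bool} => s [` oQ]%fset) => [b _|s _]; first by rewrite ffunE.
  by apply/ffunP => x; rewrite ffunE (Qo x).
have spino b : spin (c b) o = pm R b :> R.
  by rewrite /spin insubT /= ffunE.
have spinn b x : x <> o -> spin (c b) x = 1 :> R.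
  by move=> xo; rewrite /spin insubN// in_Q//; apply/asboolPn => /Qset0.
have QE (F : vertex -> R) : \sum_(x <- Q a) F x = F o.
  rewrite (perm_big [:: o]) ?big_seq1//=; apply: uniq_perm; rewrite ?fset_uniq//.
  by move=> x; rewrite in_Q// inE; apply/asboolP/eqP => /Qset0.
pose es : seq edge := [:: (o, true); (o, false); ((-1, 0), true); ((0, -1), false)].
have BE (F : edge -> R) : \sum_(e <- Bbar a) F e = \sum_(e <- es) F e.
  apply: perm_big; apply: uniq_perm; rewrite ?fset_uniq//.
  move=> e; rewrite in_Bbar//; apply/asboolP/idP => [|].
    case: e => [[i j] []]; rewrite /src /tgt /= => -[] /Qset0 [hi hj].
    - by rewrite hi hj !inE eqxx.
    - by rewrite (_ : i = -1) ?hj ?inE//; lia.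
    - by rewrite hi hj !inE eqxx.
    - by rewrite (_ : j = -1) ?hi ?inE//; lia.
  rewrite !inE => /or4P[] /eqP ->; rewrite /src /tgt /=; [left|left|right|right]; exact/Qset0.
have W b : ising_plus_weight (c b) = expR (E4 * pm R b).
  rewrite /ising_plus_weight BE /es !big_cons big_nil /src /tgt /=.
  rewrite -[(0, 0)]/o !spino !spinn//; congr expR; rewrite /E4; ring.
have M b : expR (t * magnetization a (c b)) = expR (u * pm R b).
  by rewrite /magnetization QE spino /u mulrA.
rewrite /ising_plus_E /gibbs !sumc !W !M /pm !mulr1 !mulrN1 //.
Qed.

End SingleVertex.

Lemma exp_beta_c (R : realType) : expR (4 * beta_c R) = (1 + Num.sqrt 2) ^+ 2.
Proof.
have s0 : 0 < 1 + Num.sqrt 2 :> R by rewrite ltr_wpDr// sqrtr_ge0.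
rewrite (_ : 4 * _ = 2%:R * ln (1 + Num.sqrt 2) :> R); last first.
  by rewrite /beta_c; field.
by rewrite expRM_natl lnK.
Qed.

Section Main.
Variables (R : realType) (amax C5 : R).
Hypotheses (hamax : 1 <= amax) (hC5 : 0 < C5).
Hypothesis hising : forall a t : R, 0 < a -> a <= amax -> 0 < t ->
  ising_plus_E a (fun s => expR (t * magnetization a s)) <= expR (C5 * (t + t ^+ 2)).

(** For a = 1 the square is one vertex, whose mean spin is tanh (4 beta_c). By
    Jensen's inequality exp (t tanh (4 beta_c)) <= exp (C5 (t + t^2)) for all
    t > 0; then t tends to 0. *)
Lemma C5_lower : 94 / 100 <= C5.
Proof.
pose y : R := expR (4 * beta_c R); pose z : R := expR (- (4 * beta_c R)).
have yz : y * z = 1 by rewrite -expRD subrr expR0.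
have y0 : 0 < y := expR_gt0 _.
have z0 : 0 < z := expR_gt0 _.
have y58 : 58 / 10 <= y.
  rewrite /y exp_beta_c; have := sqr_sqrtr (ler0n R 2); have := sqrtr_ge0 (2 : R).
  set q := Num.sqrt 2 => q0 q2; have : 141 / 100 <= q by nra.
  nra.
have bias : 94 / 100 * (y + z) <= y - z by nra.
have le t : 0 < t -> 94 / 100 <= C5 * (1 + t).
  move=> t0; have a1 : (0 < 1 :> R) by [].
  have Q1 : Qset (1 : R) = box 0 by apply: Qset_box => //; lra.
  have := hising a1 hamax t0; rewrite ising_single// powR1 mulr1 -/y -/z.
  rewrite ler_pdivrMr ?addr_gt0// => h.
  pose c : R := 94 / 100 * t.
  (* Jensen: the exponential lies above its tangent at c. *)
  have jensen : expR c * (y + z) <= y * expR t + z * expR (- t).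
    have tangent v : expR c * (1 + (v - c)) <= expR v.
      have -> : expR v = expR c * expR (v - c) by rewrite -expRD addrC subrK.
      by rewrite ler_wpM2l ?expR_ge0// expR_ge1Dx.
    have h1 := ler_wpM2l (ltW y0) (tangent t).
    have h2 := ler_wpM2l (ltW z0) (tangent (- t)).
    have : 0 <= expR c * (t * (y - z) - c * (y + z)).
      by rewrite mulr_ge0 ?expR_ge0// /c; nra.
    nra.
  have : expR c <= expR (C5 * (t + t ^+ 2)).
    by rewrite -(ler_pM2r (addr_gt0 y0 z0)); exact: le_trans jensen h.
  rewrite ler_expR /c (_ : C5 * _ = C5 * (1 + t) * t); last by ring.
  by rewrite ler_pM2r.
rewrite leNgt; apply/negP => lt.
(* At this t the right-hand side is halfway between C5 and 94/100. *)
have t0 : 0 < (94 / 100 - C5) / (2 * C5) by rewrite divr_gt0 ?mulr_gt0// subr_gt0.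
have := le _ t0; rewrite mulrDr mulr1 (_ : C5 * (_ / _) = (94 / 100 - C5) / 2); last first.
  by field; rewrite gt_eqF.
lra.
Qed.

Lemma fk_E_le (a : R) rho (f g : {ffun B a -> bool} -> R) : 0 < a ->
  (forall w, f w <= g w) -> fk_E a rho f <= fk_E a rho g.
Proof.
move=> a0 fg; rewrite /fk_E /gibbs ler_wpM2r//.
  by rewrite invr_ge0; apply: sumr_ge0 => w _; exact/ltW/fk_weight_gt0.
by apply: ler_sum => w _; rewrite ler_wpM2l// ltW// fk_weight_gt0.
Qed.

Lemma fk_E_cst (a : R) rho (c : R) : 0 < a -> fk_E a rho (fun=> c) = c.
Proof.
move=> a0; rewrite /fk_E /gibbs -mulr_suml mulrAC divff ?mul1r//.
rewrite gt_eqF// (bigD1 [ffun=> true])//= ltr_wpDr ?fk_weight_gt0//.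
by apply: sumr_ge0 => w _; exact/ltW/fk_weight_gt0.
Qed.

Lemma max_csize_le (a : R) rho (w : {ffun B a -> bool}) : 0 < a ->
  (max_csize rho w <= #|` Q a|)%N.
Proof.
move=> a0; apply/bigmax_leqP_seq => C _ _; rewrite csizeE// cardfE.
exact: max_card.
Qed.

Lemma A0_le_Amax (a : R) (w : {ffun B a -> bool}) : 0 < a -> A0 a w <= Amax a wired w.
Proof.
move=> a0; rewrite ler_wpM2l ?powR_ge0// ler_nat.
apply: (@leq_bigmax_seq _ _ xpredT) => //.
have [C [CC _]] := boundary_cluster_unique w a0.
by rewrite /C0; case: xgetP => [D _ []//|/(_ C)].
Qed.

(** The cases N = 0, N = 1 and N >= 2 of the half-side N of Q. For N <= 1 the
    number of vertices of Q bounds every cluster; for N = 0 the hypothesis at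
    a itself suffices, as the single spin favours +. *)
Lemma wired_Amax_bound (a t : R) : 0 < a -> a <= amax -> 0 < t ->
  fk_E a wired (fun w => expR (t * Amax a wired w)) <= 2 * expR (C5 * (t + t ^+ 2)).
Proof.
move=> a0 aM t0; have C5l := C5_lower.
have [N /andP[Na aN]] := half_side_exists a0.
pose z := a `^ (15 / 8); have z0 : 0 <= z := powR_ge0 _ _.
have ln2 (y : R) : y <= 65 / 100 -> expR y <= 2.
  by move=> ly; apply: le_trans (expR_065 R); rewrite ler_expR.
have AE w : expR (t * Amax a wired w) = expR (t * z * (max_csize wired w)%:R).
  by rewrite /Amax mulrA.
have trivial_bound : fk_E a wired (fun w => expR (t * Amax a wired w)) <=
    expR (t * z * #|` Q a|%:R).
  rewrite -[leRHS](fk_E_cst wired _ a0); apply: fk_E_le => // w.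
  by rewrite AE ler_expR ler_wpM2l ?ler_nat ?max_csize_le// mulr_ge0// ltW.
have [N0|N1|N2] : [\/ N = 0, N = 1 | (2 <= N)%N]%N.
  by case: (N) => [|[|k]]; [constructor 1|constructor 2|constructor 3].
- have Qa : Qset a = box 0 by apply: Qset_box => //; move: Na aN; rewrite N0 => -> ->.
  apply: le_trans trivial_bound _; rewrite (card_Q a0 Qa) /= mulr1.
  have := hising a0 aM t0; rewrite ising_single// -/z.
  set y := expR (4 * _); set y' := expR (- _) => h.
  have y'y : y' <= y by rewrite ler_expR; have := beta_c_gt0 R; lra.
  have y'0 : 0 < y' := expR_gt0 _.
  have y0 : 0 < y := expR_gt0 _.
  have : expR (t * z) <= 2 * ((y * expR (t * z) + y' * expR (- (t * z))) / (y + y')).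
    rewrite mulrA ler_pdivlMr ?addr_gt0//.
    have e0 := expR_gt0 (t * z); have := mulr_gt0 y'0 (expR_gt0 (- (t * z))); nra.
  lra.
- have Qa : Qset a = box 1 by apply: Qset_box => //; move: Na aN; rewrite N1 => -> ->.
  apply: le_trans trivial_bound _; rewrite (card_Q a0 Qa) /=.
  have a2 : a <= 1 / 2.
    by move: Na; rewrite N1 ler_pdivlMr//; lra.
  (* The constant 3.66 is just below 2^(15/8), and a <= 1/2. *)
  have zle : z <= 100 / 366.
    apply: pow158_le; [exact: ltW|lra|].
    apply: (@le_trans _ _ ((1 / 2) ^+ 15)); first by rewrite lerXn2r ?nnegrE// ltW.
    lra.
  rewrite -ler_pdivrMr ?expR_gt0// -expRN -expRD; apply: ln2.
  have : t * z <= 100 / 366 * t by rewrite mulrC ler_wpM2r// ltW.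
  set h := t * z => hle.
  have h0 : 0 <= h by rewrite mulr_ge0// ltW.
  have : 94 / 100 * (t + t ^+ 2) <= C5 * (t + t ^+ 2).
    by rewrite ler_wpM2r// addr_ge0 ?sqr_ge0 ?ltW.
  have : (366 / 100 * h) ^+ 2 <= t ^+ 2 by apply: lerXn2r; rewrite ?nnegrE; lra.
  (* h = 1/5 is close to the minimiser of the quadratic polynomial in h. *)
  have := sqr_ge0 (h - 1 / 5); rewrite (_ : ((2 * 1).+1 ^ 2)%:R = 9)//; nra.
- have [n Nn] : exists n, N = n.+2 by exists (N - 2)%N; rewrite -addn2 subnK.
  pose a' : R := 1 / (2 * n.+1%:R).
  have n1 : 1 <= n.+1%:R :> R by rewrite ler1n.
  have a'0 : 0 < a' by rewrite divr_gt0// mulr_gt0.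
  have Qa : Qset a = box n.+2 by apply: Qset_box => //; move: Na aN; rewrite Nn => -> ->.
  have Qa' : Qset a' = box n.+1.
    apply: Qset_box => //; rewrite (_ : 1 / 2 / a' = n.+1%:R) ?lexx ?ltr_nat ?ltnSn//.
    by rewrite /a'; move: n1; set x := n.+1%:R => x1; field; rewrite gt_eqF//; lra.
  have a'M : a' <= amax.
    by apply: le_trans hamax; rewrite ler_pdivrMr ?mulr_gt0//; lra.
  have NR : N%:R = n.+1%:R + 1 :> R by rewrite Nn -natr1.
  have NaR : N%:R * (2 * a) <= 1.
    by move: Na; rewrite ler_pdivlMr// => ?; lra.
  pose r := a / a'; have r0 : 0 < r by rewrite divr_gt0.
  have rN : r * N%:R <= N%:R - 1.
    rewrite /r /a' NR.
    rewrite (_ : _ * _ = n.+1%:R * (N%:R * (2 * a))); last first.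
      by rewrite NR; field; rewrite ?gt_eqF//; lra.
    by rewrite addrK ler_piMr//; lra.
  have N2R : 2 <= N%:R :> R by rewrite ler_nat.
  have r1 : r <= 1 by nra.
  pose k := r `^ (15 / 8); have k0 : 0 <= k := powR_ge0 _ _.
  have kr : k <= r by apply: pow158_le; [exact: ltW|exact: ltW|rewrite ler_wiXn2l// ltW].
  have k_gt0 : 0 < k by rewrite powR_gt0.
  have zk : z = k * a' `^ (15 / 8).
    by rewrite -powRM ?ltW// /r divfK// gt_eqF.
  have t'0 : 0 < t * k by rewrite mulr_gt0.
  have [inb outb] := box_succ_boundary n.+1.
  have bQ : ((n.+2%:Z, 0) : vertex) \in Q a by rewrite in_Q//; apply/asboolP; rewrite Qa.
  have nb : ~ Qset a' (val [` bQ]%fset) by rewrite Qa'.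
  have h0 : 0 <= t * z by rewrite mulr_ge0// ltW.
  have := wired_le_ising a0 a'0 Qa Qa' h0 nb.
  rewrite (card_shell a0 a'0 Qa Qa') -Nn.
  under eq_fun do rewrite -AE.
  move=> /le_trans; apply.
  have ising : ising_plus_E a' (fun s => expR (t * z * \sum_(x <- Q a') spin s x)) <=
      expR (C5 * (t * k + (t * k) ^+ 2)).
    apply: le_trans (hising a'0 a'M t'0); rewrite le_eqVlt; apply/orP; left; apply/eqP.
    by congr ising_plus_E; apply/funext => s; rewrite /magnetization zk !mulrA.
  have tk : t * k <= t by apply: ler_piMr; [exact: ltW|exact: le_trans kr r1].
  have [_|_] := leP 2 (expR (t * z * (8 * N)%:R)); last first.
    rewrite ler_wpM2l//; apply: le_trans ising _.
    rewrite ler_expR; apply: ler_wpM2l; first exact: ltW.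
    by apply: lerD => //; apply: lerXn2r => //; rewrite nnegrE ltW.
  apply: (@le_trans _ _ (expR (t * z * (8 * N)%:R) * expR (C5 * (t * k + (t * k) ^+ 2)))).
    by rewrite ler_wpM2l ?expR_ge0.
  rewrite -ler_pdivrMr ?expR_gt0// -expRN -!expRD; apply: ln2.
  set K := z * (8 * N)%:R.
  have K0 : 0 <= K by rewrite mulr_ge0.
  (* As a N <= 1/2 and N >= 2, K^2 N is at most 8 4^(-3/4) < 3.6. *)
  have KN : K ^+ 2 * N%:R <= 36 / 10.
    rewrite -(@ler_pXn2r _ 4)// ?nnegrE ?mulr_ge0 ?sqr_ge0//.
    have -> : (K ^+ 2 * N%:R) ^+ 4 = 2 ^+ 24 * N%:R ^+ 12 * a ^+ 15.
      by rewrite -(pow158 (ltW a0)) -/z /K natrM; ring.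
    have aN15 : (a * N%:R) ^+ 15 <= (1 / 2) ^+ 15.
      have aN0 : 0 <= a * N%:R by rewrite mulr_ge0// ltW.
      have aN2 : a * N%:R <= 1 / 2 by nra.
      by apply: lerXn2r; rewrite ?nnegrE//; lra.
    have N3 : 2 ^+ 3 <= N%:R ^+ 3 :> R by rewrite lerXn2r// nnegrE.
    have aN12 : 0 <= N%:R ^+ 12 * a ^+ 15 by rewrite mulr_ge0// exprn_ge0// ltW.
    have : N%:R ^+ 12 * a ^+ 15 * 2 ^+ 3 <= (1 / 2) ^+ 15.
      apply: le_trans aN15; rewrite (_ : (a * _) ^+ 15 = N%:R ^+ 12 * a ^+ 15 * N%:R ^+ 3); last by ring.
      by rewrite ler_wpM2l.
    by rewrite -[2 ^+ 24 * _ * _]mulrA; set P := N%:R ^+ 12 * a ^+ 15; lra.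
  have Ngt0 : 0 < N%:R :> R by lra.
  pose m : R := N%:R^-1; have m0 : 0 < m by rewrite invr_gt0.
  have mN : m * N%:R = 1 by rewrite mulVf// gt_eqF.
  have m2 : m <= 1 / 2 by nra.
  have km : k <= 1 - m by apply: le_trans kr _; rewrite -(ler_pM2r Ngt0); nra.
  have Km : K ^+ 2 <= 36 / 10 * m by rewrite -(ler_pM2r Ngt0); nra.
  have k2 : k ^+ 2 <= 1 - 3 / 2 * m by nra.
  (* 65/100 is the lower bound used for log 2, and 26/10 = 4 * 65/100. *)
  have amgm : t * K <= 65 / 100 + t ^+ 2 * K ^+ 2 / (26 / 10).
    have := sqr_ge0 (t * K / (26 / 10) - 1 / 2); nra.
  have t2 : 0 < t ^+ 2 by rewrite exprn_gt0.
  have tK2 : t ^+ 2 * K ^+ 2 <= t ^+ 2 * (36 / 10 * m) by rewrite ler_wpM2l// ltW.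
  have gain : t ^+ 2 * (3 / 2 * m) <= (t + t ^+ 2) - (t * k + (t * k) ^+ 2).
    have : t ^+ 2 * (3 / 2 * m) <= t ^+ 2 * (1 - k ^+ 2) by apply: ler_wpM2l; [exact: ltW|lra].
    by rewrite exprMn; nra.
  have g0 : 0 <= t ^+ 2 * (3 / 2 * m) by rewrite !mulr_ge0// ltW.
  have gainC : 94 / 100 * (t ^+ 2 * (3 / 2 * m)) <=
      C5 * ((t + t ^+ 2) - (t * k + (t * k) ^+ 2)).
    by rewrite ler_pM.
  have tm : 0 <= t ^+ 2 * m by rewrite mulr_ge0// ltW.
  by rewrite -mulrA -/K; lra.
Qed.

End Main.

(** * The theorem *)

Unset Implicit Arguments.

Theorem proposition5 (R : realType) (amax : R) (hamax : 1 <= amax)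
    (C5 : R) (hC5 : 0 < C5)
    (hising : forall a t : R, 0 < a -> a <= amax -> 0 < t ->
       ising_plus_E a (fun s => expR (t * magnetization a s))
         <= expR (C5 * (t + t ^+ 2))) :
  forall a t : R, 0 < a -> a <= amax -> 0 < t ->
    fk_E a wired (fun w => expR (t * A0 a w))
      <= 2 * expR (C5 * (t + t ^+ 2))
    /\ forall rho : int * int * bool -> bool,
      fk_E a rho (fun w => expR (t * Amax a rho w))
        <= 2 * expR (C5 * (t + t ^+ 2)).
Proof.
move=> a t a0 aM t0; have main := wired_Amax_bound hamax hC5 hising a0 aM t0.
split=> [|rho]; apply: le_trans main.
  by apply: fk_E_le => // w; rewrite ler_expR ler_wpM2l ?A0_le_Amax ?ltW.
by apply: fk_E_le_wired => //; exact: ltW.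
Qed.
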